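(* For $n\geq3$, the subgroup of $\mathcal{PI}_n$ generated by all doubled commutator transvections is a proper subgroup of $\mathcal{PI}_n$.
   Context: Let $F_n$ be the free group on a fixed free basis $X=\{x_1,\dots,x_n\}$. For a word $w=l_1\cdots l_k$ on $X^{\pm1}$, its reverse is $w^{\mathrm{rev}}=l_k\cdots l_1$; $w$ is a palindrome on $X$ if $w^{\mathrm{rev}}=w$. The palindromic automorphism group $\Pi\mathrm{A}_n\leq\mathrm{Aut}(F_n)$ consists of those $\alpha$ such that each $\alpha(x_i)$ may be written as a palindrome on $X$. The palindromic Torelli group $\mathcal{PI}_n$ is the subgroup of $\Pi\mathrm{A}_n$ of elements acting trivially on the abelianisation of $F_n$. A $\pi$-basis is a set of the form $\alpha(X)$ with $\alpha\in\Pi\mathrm{A}_n$. Write $[g,h]=ghg^{-1}h^{-1}$. An element $\phi\in\mathcal{PI}_n$ is a doubled commutator transvection if there are a $\pi$-basis $Y$ and distinct $y_1,y_2,y_3\in Y$ such that $\phi(y_1)=[y_2,y_3]^{\mathrm{rev}}\,y_1\,[y_2,y_3]$ and $\phi$ fixes every other member of $Y$. *)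

(* Defs.v *)
From HB Require Import structures.
From mathcomp Require Import all_boot.
From mathcomp Require Import boolp classical_sets.

Set Implicit Arguments.
Unset Strict Implicit.
Unset Printing Implicit Defensive.

Local Open Scope classical_set_scope.
Local Open Scope group_scope.

(* The free group on an alphabet X, as the set of freely reduced words. *)
Section FreeGroup.
Variable X : choiceType.

(* (x, false) is the letter x, and (x, true) is the letter x^-1. *)
Notation letter := (X * bool)%type (only parsing).
Definition word : Type := seq letter.

Definition linv (a : letter) : letter := (a.1, ~~ a.2).
Definition winv (w : word) : word := rev (map linv w).

Definition reduced (w : word) : bool := sorted (fun a b => b != linv a) w.

(* The reduced form of the word a :: w, when w is reduced. *)
Definition push (a : letter) (w : word) : word :=
  if w is b :: w' then if b == linv a then w' else a :: w else [:: a].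

Definition reduce (w : word) : word := foldr push [::] w.

Lemma linvK : involutive linv.
Proof. by case=> x b; rewrite /linv /= negbK. Qed.

Lemma linv_neq a : (linv a == a) = false.
Proof. by case: a => x []; rewrite /linv /= xpair_eqE andbF. Qed.

Lemma reduced_behead a w : reduced (a :: w) -> reduced w.
Proof. by case: w => //= b w /andP[]. Qed.

Lemma push_reduced a w : reduced w -> reduced (push a w).
Proof.
case: w => [//|b w] rw /=; case: eqP => [_|/eqP ba].
  exact: reduced_behead rw.
by rewrite /reduced /= ba.
Qed.

Lemma act_reduced u w : reduced w -> reduced (foldr push w u).
Proof. by move=> rw; elim: u => //= a u; apply: push_reduced. Qed.

Lemma reduce_reduced w : reduced (reduce w).
Proof. exact: act_reduced. Qed.

Lemma pushK a w : reduced w -> push (linv a) (push a w) = w.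
Proof.
case: w => [|b w] rw /=; first by rewrite linvK eqxx.
case: eqP => [eb|_] /=; last by rewrite linvK eqxx.
case: w rw => [|c w] /=; first by rewrite eb.
by rewrite eb => /andP[/negPf -> _].
Qed.

Lemma pushVK a w : reduced w -> push a (push (linv a) w) = w.
Proof. by move=> rw; rewrite -{1}[a]linvK pushK. Qed.

Lemma reduce_id w : reduced w -> reduce w = w.
Proof.
elim: w => //= a w IHw rw; rewrite IHw ?(reduced_behead rw) //.
by case: w rw {IHw} => //= b w /andP[/negPf ->].
Qed.

Lemma act_push a u w : reduced w ->
  foldr push w (push a u) = push a (foldr push w u).
Proof.
move=> rw; case: u => [//|b u] /=; case: eqP => [->|//].
by rewrite pushVK // act_reduced.
Qed.

Lemma act_reduce u w : reduced w -> foldr push w (reduce u) = foldr push w u.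
Proof. by move=> rw; elim: u => //= a u IHu; rewrite act_push // IHu. Qed.

Lemma reduce_catl u v : reduce (reduce u ++ v) = reduce (u ++ v).
Proof. by rewrite /reduce !foldr_cat act_reduce // reduce_reduced. Qed.

Lemma reduce_catr u v : reduce (u ++ reduce v) = reduce (u ++ v).
Proof.
by rewrite {1 3}/reduce !foldr_cat -/(reduce _) reduce_id // reduce_reduced.
Qed.

Lemma winvK : involutive winv.
Proof. by move=> w; rewrite /winv map_rev revK (mapK linvK). Qed.

Lemma reduce_winv u : reduce (winv u ++ u) = [::].
Proof.
suff actK w : reduced w -> foldr push (foldr push w u) (winv u) = w.
  by rewrite /reduce foldr_cat actK.
elim: u => //= a u IHu rw.
by rewrite /winv /= rev_cons -cats1 foldr_cat /= pushK ?IHu ?act_reduced.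
Qed.

Record free_group : Type :=
  FreeGroup { fword :> seq (X * bool); fword_reduced : reduced fword }.

HB.instance Definition _ := [isSub for fword].
HB.instance Definition _ := [Choice of free_group by <:].

(* The element of the free group represented by an arbitrary word. *)
Definition word_class (w : word) : free_group :=
  FreeGroup (reduce_reduced w).

Definition fg_one : free_group := word_class [::].
Definition fg_mul (u v : free_group) : free_group := word_class (u ++ v).
Definition fg_inv (u : free_group) : free_group := word_class (winv u).

Lemma fg_mulA : associative fg_mul.
Proof. by move=> u v w; apply: val_inj; rewrite /= reduce_catl reduce_catr catA. Qed.

Lemma fg_mul1 : left_id fg_one fg_mul.
Proof. by move=> u; apply: val_inj; rewrite /= reduce_id // fword_reduced. Qed.

Lemma fg_mulr1 : right_id fg_one fg_mul.
Proof.
by move=> u; apply: val_inj; rewrite /= cats0 reduce_id // fword_reduced.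
Qed.

Lemma fg_mulV : left_inverse fg_one fg_inv fg_mul.
Proof. by move=> u; apply: val_inj; rewrite /= reduce_catl reduce_winv. Qed.

Lemma fg_mulrV : right_inverse fg_one fg_inv fg_mul.
Proof.
move=> u; apply: val_inj; rewrite /= reduce_catr.
by rewrite -{1}[fword u]winvK reduce_winv.
Qed.

HB.instance Definition _ :=
  isGroup.Build free_group fg_mulA fg_mul1 fg_mulr1 fg_mulV fg_mulrV.

Definition fgen (x : X) : free_group := word_class [:: (x, false)].

Definition palindrome (w : word) : Prop := rev w = w.

(* The reverse, with respect to X, of an element of the free group. *)
Definition frev (g : free_group) : free_group := word_class (rev g).

Lemma rev_reduced w : reduced w -> reduced (rev w).
Proof.
rewrite /reduced rev_sorted; congr (is_true _); apply: eq_sorted => a b.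
by congr negb; apply/eqP/eqP => ->; rewrite linvK.
Qed.

Lemma reduce_rev w : reduce (rev (reduce w)) = reduce (rev w).
Proof.
elim: w => //= a w IHw; rewrite rev_cons -cats1 -reduce_catl -IHw reduce_catl.
case: (reduce w) => [//|b r] /=; case: eqP => [->|_].
  rewrite rev_cons -cats1 -catA -reduce_catr /=.
  by rewrite linvK eqxx cats0.
by rewrite !rev_cons -!cats1.
Qed.

Lemma frevM g h : frev (g * h) = frev h * frev g.
Proof.
apply: val_inj; rewrite /= reduce_rev rev_cat reduce_catl reduce_catr.
by [].
Qed.

Lemma frevV g : frev g^-1 = (frev g)^-1.
Proof.
apply: (mulgI (frev g)); rewrite mulgV -frevM mulVg.
exact: val_inj.
Qed.

Lemma frev_gen x : frev (fgen x) = fgen x.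
Proof. exact: val_inj. Qed.

Lemma frev_palindrome w : palindrome w -> frev (word_class w) = word_class w.
Proof. by move=> pw; apply: val_inj; rewrite /= reduce_rev pw. Qed.

Lemma palindrome_frev g : frev g = g -> palindrome g.
Proof.
move=> /(congr1 (@fword)) /=.
by rewrite reduce_id // rev_reduced // fword_reduced.
Qed.

Lemma free_group_ind (P : free_group -> Prop) :
    P 1 -> (forall x g, P g -> P (fgen x * g)) ->
    (forall x g, P g -> P ((fgen x)^-1 * g)) -> forall g, P g.
Proof.
move=> P1 PM PV g; have -> : g = word_class g.
  by apply: val_inj; rewrite /= reduce_id // fword_reduced.
elim: (fword g) => [//|[x b] w Pw].
have -> : word_class ((x, b) :: w) = word_class [:: (x, b)] * word_class w.
  by apply: val_inj; rewrite [RHS]reduce_catl reduce_catr.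
case: b; last exact: PM.
suff -> : word_class [:: (x, true)] = (fgen x)^-1 by apply: PV.
exact: val_inj.
Qed.

End FreeGroup.

Section Groups.
Variable G : groupType.

Definition is_subgroup (H : set G) : Prop :=
  [/\ H 1, forall x y, H x -> H y -> H (x * y) & forall x, H x -> H x^-1].

Definition generated (S : set G) : set G := smallest is_subgroup S.

Definition proper_subgroup (H K : set G) : Prop := is_subgroup H /\ H `<` K.

(* MathComp's [~ g, h] is the other convention, g^-1 h^-1 g h. *)
Definition commutator (g h : G) : G := g * h * g^-1 * h^-1.

Definition derived_subgroup : set G :=
  generated [set commutator g h | g in setT & h in setT].

(* The image of g in the abelianisation of G, as a coset. *)
Definition abel_class (g : G) : set G := [set g * d | d in derived_subgroup].

Record aut : Type := Aut {
  aut_fun :> G -> G;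
  autM : {morph aut_fun : x y / x * y};
  aut_bij : bijective aut_fun
}.

Lemma aut_ext (f g : aut) : f =1 g -> f = g.
Proof.
case: f g => [f fM fb] [g gM gb] /= /funext efg; case: _ / efg in gM gb *.
by congr Aut; apply: Prop_irrelevance.
Qed.

HB.instance Definition _ := gen_eqMixin aut.
HB.instance Definition _ := gen_choiceMixin aut.

Definition aut_one : aut :=
  @Aut id (fun _ _ => erefl) (Bijective (fun=> erefl) (fun=> erefl)).

Lemma aut_compM (f g : aut) : {morph f \o g : x y / x * y}.
Proof. by move=> x y /=; rewrite !autM. Qed.

Definition aut_comp (f g : aut) : aut :=
  Aut (aut_compM f g) (bij_comp (aut_bij f) (aut_bij g)).

Lemma aut_surj (f : aut) (y : G) : exists x, f x == y.
Proof. by case: (aut_bij f) => g _ fK; exists (g y); rewrite fK. Qed.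

Definition aut_inv_fun (f : aut) (y : G) : G := xchoose (aut_surj f y).

Lemma aut_inv_funK (f : aut) : cancel (aut_inv_fun f) f.
Proof. by move=> y; apply/eqP/(xchooseP (aut_surj f y)). Qed.

Lemma aut_funK (f : aut) : cancel f (aut_inv_fun f).
Proof. by move=> x; apply: (bij_inj (aut_bij f)); rewrite aut_inv_funK. Qed.

Lemma aut_invM (f : aut) : {morph aut_inv_fun f : x y / x * y}.
Proof.
by move=> x y; apply: (bij_inj (aut_bij f)); rewrite autM !aut_inv_funK.
Qed.

Definition aut_inv (f : aut) : aut :=
  Aut (@aut_invM f) (Bijective (aut_inv_funK f) (aut_funK f)).

Lemma aut_compA : associative aut_comp.
Proof. by move=> f g h; apply: aut_ext. Qed.

Lemma aut_comp1 : left_id aut_one aut_comp.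
Proof. by move=> f; apply: aut_ext. Qed.

Lemma aut_compr1 : right_id aut_one aut_comp.
Proof. by move=> f; apply: aut_ext. Qed.

Lemma aut_compV : left_inverse aut_one aut_inv aut_comp.
Proof. by move=> f; apply: aut_ext => x /=; rewrite aut_funK. Qed.

Lemma aut_comprV : right_inverse aut_one aut_inv aut_comp.
Proof. by move=> f; apply: aut_ext => x /=; rewrite aut_inv_funK. Qed.

(* The product of automorphisms is composition: (f * g) x = f (g x). *)
HB.instance Definition _ :=
  isGroup.Build aut aut_compA aut_comp1 aut_compr1 aut_compV aut_comprV.

Lemma aut1 (f : aut) : f 1 = 1.
Proof. by apply: (mulgI (f 1)); rewrite -autM !mulg1. Qed.

Lemma autV (f : aut) : {morph f : x / x^-1}.
Proof. by move=> x; apply: (mulgI (f x)); rewrite -autM !mulgV aut1. Qed.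

End Groups.

Section Palindromic.
Variable n : nat.

Local Notation F := (free_group 'I_n).

Definition palindromic_aut : set (aut F) :=
  [set f | forall i : 'I_n,
     exists2 w : word 'I_n, palindrome w & f (fgen i) = word_class w].

Definition palindromic_torelli : set (aut F) :=
  [set f | palindromic_aut f /\ forall g : F, abel_class (f g) = abel_class g].

Lemma palindromic_autP (f : aut F) :
  palindromic_aut f <-> forall g, f (frev g) = frev (f g).
Proof.
split=> [pf | fC i]; last first.
  exists (fword (f (fgen i))).
    by apply: palindrome_frev; rewrite -fC frev_gen.
  by apply: val_inj; rewrite /= reduce_id // fword_reduced.
have fx i : f (frev (fgen i)) = frev (f (fgen i)).
  by have [w pw ew] := pf i; rewrite frev_gen ew frev_palindrome.
elim/free_group_ind => [|i g IHg|i g IHg].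
- have -> : frev (1 : F) = 1 by apply: val_inj.
  by rewrite aut1; apply: val_inj.
- by rewrite frevM !autM frevM IHg; congr (_ * _); apply: fx.
- rewrite frevM frevV !autM !autV frevM frevV IHg.
  by congr (_ * _^-1); apply: fx.
Qed.

Lemma palindromic_aut_subgroup : is_subgroup palindromic_aut.
Proof.
split=> [|f g /palindromic_autP fC /palindromic_autP gC|f /palindromic_autP fC].
- by apply: (proj2 (palindromic_autP 1)) => g.
- by apply/palindromic_autP => x /=; rewrite gC fC.
- apply/palindromic_autP => x; apply: (bij_inj (aut_bij f)).
  by rewrite fC !(aut_inv_funK f).
Qed.

Lemma palindromic_torelli_subgroup : is_subgroup palindromic_torelli.
Proof.
have [p1 pM pV] := palindromic_aut_subgroup.
split=> [|f g [pf tf] [pg tg]|f [pf tf]]; split=> //; first exact: pM.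
- by move=> x; rewrite -(tg x) -(tf (g x)).
- exact: pV.
- by move=> x; rewrite -[LHS]tf (aut_inv_funK f).
Qed.

Definition pi_basis (Y : set F) : Prop :=
  exists2 f : aut F, palindromic_aut f & Y = [set f (fgen i) | i in [set: 'I_n]].

Definition doubled_commutator_transvection : set (aut F) :=
  [set phi | palindromic_torelli phi /\
     exists Y, pi_basis Y /\
     exists y1 y2 y3 : F,
     [/\ [/\ Y y1, Y y2 & Y y3],
         [/\ y1 <> y2, y1 <> y3 & y2 <> y3],
         phi y1 = frev (commutator y2 y3) * y1 * commutator y2 y3 &
         forall y, Y y -> y <> y1 -> phi y = y]].

End Palindromic.

(* Main.v *)
(* A palindromic Torelli automorphism phi sends a generator x to
   u^rev x u for a unique u in F, which lies in [F, F].  The coefficient of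
   x /\ y (y another generator) in the image of u in the second exterior power
   of the abelianisation, taken modulo 2, is additive in phi: it is read off the
   Heisenberg representation x |-> A, y |-> B, all other generators |-> 1, which
   is invariant under phi because it turns reversal into an antiautomorphism.
   It vanishes on doubled commutator transvections, since palindromic
   automorphisms permute the generators modulo 2: if y_1 is congruent to x, then
   y_2 and y_3 have even x-exponent.  It is odd on the separating twist that
   maps each t in {x, y, z} to c^rev t c with c = x^-1 y z^-1 x y^-1 z and fixes
   the other generators. *)
Require Import Defs.
From mathcomp Require Import all_boot.
From HB Require Import structures.
From mathcomp Require Import ssralg ssrint intdiv ring zify.
From mathcomp Require Import boolp classical_sets.

Set Implicit Arguments.
Unset Strict Implicit.
Unset Printing Implicit Defensive.

Local Open Scope classical_set_scope.
Local Open Scope group_scope.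

(** * Reversal, palindromes and letter parity in free groups *)

Section FreeGroupLemmas.
Variable X : choiceType.
Implicit Types (x : X) (g h u v : free_group X) (s : word X).

Lemma word_class_id g : word_class g = g.
Proof. by apply: val_inj; rewrite /= reduce_id // fword_reduced. Qed.

Lemma word_class_cat s t : word_class (s ++ t) = word_class s * word_class t.
Proof. by apply: val_inj; rewrite [RHS]reduce_catl reduce_catr. Qed.

Lemma word_class_rev s : word_class (rev s) = frev (word_class s).
Proof. by apply: val_inj; rewrite /= reduce_rev. Qed.

Lemma word_class_inv x : word_class [:: (x, true)] = (fgen x)^-1.
Proof. exact: val_inj. Qed.

Lemma frevK : involutive (@frev X).
Proof. by move=> g; rewrite -(word_class_id g) -!word_class_rev revK. Qed.

Lemma frev1 : frev (1 : free_group X) = 1.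
Proof. exact: val_inj. Qed.

Lemma reduced_winv s : reduced s -> reduced (winv s).
Proof.
move=> rs; apply: rev_reduced; rewrite /reduced sorted_map.
by move: rs; apply: sub_sorted => a b; apply: contra => /eqP/(can_inj (@linvK X)) ->.
Qed.

(* For the letterwise inversion [map linv], the hypothesis says that conjugation
   by [x] inverts every letter of [u]; comparing first letters excludes any
   nonempty reduced word. *)
Lemma revconj_gen_eq x u : frev u * fgen x * u = fgen x -> u = 1.
Proof.
move=> E; have {}E : frev u * fgen x = fgen x * u^-1.
  by rewrite -[in RHS]E mulgK.
have rs := fword_reduced u; set s := fword u in rs.
have rw := reduced_winv rs; set l := (x, false) : X * bool.
have {E} : rev (push l s) = push l (winv s).
  have := congr1 (@fword X) E.
  rewrite -[u in LHS]word_class_id -word_class_rev -[u in RHS]word_class_id.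
  rewrite -word_class_cat.
  have -> : fgen x * (word_class u)^-1 = word_class (l :: winv s).
    rewrite -cat1s word_class_cat; congr (_ * _); apply: val_inj => /=.
    by rewrite (reduce_id rs).
  rewrite /= -/s (reduce_id rw) cats1 -rev_cons -reduce_rev /= (reduce_id rs).
  by rewrite reduce_id // rev_reduced // push_reduced.
suff : s = [::] \/ rev (push l s) <> push l (winv s).
  case=> [s0 _|//]; apply: val_inj; exact: s0.
clearbody s l; clear x u.
have wE : rev (winv s) = map (@linv X) s by rewrite /winv revK.
case Es: s => [|b s']; first by left.
right; rewrite -Es => E.
have sw : size (winv s) = size s by rewrite size_rev size_map.
(* If [s] starts with [linv l], both sides of [E] cancel, which forces [linv l = l] or an [l] as
   second letter of the reduced word [s]. *)
case: (eqVneq b (linv l)) => [bl|bl].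
  have pls : push l s = s' by rewrite Es /= bl eqxx.
  case Ew: (winv s) => [|d t]; first by move: sw; rewrite Ew Es.
  rewrite pls Ew /= in E; move: E; case: eqP => [dl E|_ E]; last first.
    by move/(congr1 size): E; move: sw; rewrite size_rev Ew Es /=; lia.
  move: wE; rewrite Ew dl -E Es bl rev_cons revK /= linvK.
  move: rs; rewrite Es bl; case: (s') => [_ [/eqP]|e r].
    by rewrite linv_neq.
  rewrite /reduced /= linvK => /andP[/eqP ne _] /(congr1 (head l)) le.
  exact: ne le.
have pls : push l s = l :: s by rewrite Es /= (negPf bl).
rewrite pls in E.
have {}E : rcons (rev s) l = l :: winv s.
  rewrite -rev_cons E; case Ew: (winv s) => [//|d t] /=; case: eqP => // dl.
  move/(congr1 size): E; rewrite Ew /= dl eqxx rev_cons size_rcons size_rev.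
  by rewrite -sw Ew /=; lia.
move/(congr1 rev): E; rewrite rev_rcons revK rev_cons wE Es /= => -[e _].
by rewrite e linvK eqxx in bl.
Qed.

(** The element [u * v^-1] satisfies the hypothesis of [revconj_gen_eq]. This makes the conjugator
    attached to the image of [x] well defined. *)
Lemma revconj_gen_inj x u v :
  frev u * fgen x * u = frev v * fgen x * v -> u = v.
Proof.
move=> E; apply/(mulIg v^-1); rewrite mulgV; apply: (@revconj_gen_eq x).
rewrite frevM frevV.
rewrite !mulgA -(mulgA _ (frev u)) -(mulgA _ (_ * _)) E.
by rewrite !mulgA mulVg mul1g mulgK.
Qed.

Lemma palindrome_split s : palindrome s ->
  exists t, s = rev t ++ t \/ exists a, s = rev t ++ a :: t.
Proof.
move=> ps; set k := (size s)./2; exists (rev (take k s)); rewrite revK.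
have st : rev (take k s) = drop (size s - k) s by rewrite -{1}ps take_rev revK.
have sE : size s = odd (size s) + k.*2 by rewrite odd_double_half.
case: (boolP (odd (size s))) sE => _ sE; [right|left].
  case Ed: (drop k s) => [|a t].
    by move/(congr1 size): Ed; rewrite size_drop /= sE; lia.
  exists a; rewrite -[LHS](cat_take_drop k) Ed; congr (_ ++ a :: _).
  rewrite st; have -> : size s - k = k.+1 by lia.
  by rewrite -add1n -drop_drop Ed /= drop0.
by rewrite st; have -> : size s - k = k by [lia]; rewrite cat_take_drop.
Qed.

Lemma frev_fixed_split g : frev g = g ->
  exists a, g = frev a * a \/ exists x, g = frev a * fgen x * a.
Proof.
move=> /palindrome_frev/palindrome_split[t []].
  move=> gE; exists (word_class t); left.
  by rewrite -word_class_rev -word_class_cat -gE word_class_id.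
case=> -[x b] gE.
have {gE} : g = frev (word_class t) * word_class [:: (x, b)] * word_class t.
  by rewrite -word_class_rev -!word_class_cat -catA -gE word_class_id.
case: b => ->; last by exists (word_class t); right; exists x.
(* Writing [x^-1] as [x^-1 * x * x^-1] turns a central letter [x^-1] into [x]. *)
exists ((fgen x)^-1 * word_class t); right; exists x.
by rewrite word_class_inv frevM frevV frev_gen !mulgA mulgVK.
Qed.

(** Counting [x] and [x^-1] alike gives the exponent sum of [x] modulo 2, a homomorphism to Z/2 that
    ignores reversal. *)
Definition parity (x : X) g : bool := odd (count (fun a => a.1 == x) g).

Lemma odd_count_push x a s :
  odd (count (fun b => b.1 == x) (push a s)) =
  (a.1 == x) (+) odd (count (fun b => b.1 == x) s).
Proof.
case: s => [|b s] /=; first by rewrite addn0 oddb addbF.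
by case: eqP => [->|_] /=; rewrite !oddD !oddb ?addKb.
Qed.

Lemma parity_class x s :
  parity x (word_class s) = odd (count (fun b => b.1 == x) s).
Proof.
rewrite /parity /=; elim: s => //= a s IHs.
by rewrite odd_count_push IHs oddD oddb.
Qed.

Lemma parityM x g h : parity x (g * h) = parity x g (+) parity x h.
Proof. by rewrite [LHS]parity_class count_cat oddD. Qed.

Lemma parity_frev x g : parity x (frev g) = parity x g.
Proof. by rewrite [LHS]parity_class count_rev. Qed.

Lemma parity_gen x y : parity x (fgen y) = (y == x).
Proof. by rewrite /parity /= addn0 oddb. Qed.

Lemma parity_revconj x g h : parity x (frev g * h * g) = parity x h.
Proof. by rewrite !parityM parity_frev addbAC addbb. Qed.

End FreeGroupLemmas.

(** * Universal property of the free group *)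

Section Lift.
Variables (X : choiceType) (G : groupType) (f : X -> G).

Definition letter_lift (a : X * bool) : G := if a.2 then (f a.1)^-1 else f a.1.

Definition word_lift (s : word X) : G := foldr (fun a z => letter_lift a * z) 1 s.

Definition lift (g : free_group X) : G := word_lift g.

Lemma word_lift_push a s : word_lift (push a s) = letter_lift a * word_lift s.
Proof.
case: s => [//|b s] /=; case: eqP => [->|//].
by rewrite mulgA; case: a => x [] /=; rewrite /letter_lift /= ?mulVg ?mulgV mul1g.
Qed.

Lemma lift_class s : lift (word_class s) = word_lift s.
Proof. by rewrite /lift /=; elim: s => //= a s IHs; rewrite word_lift_push IHs. Qed.

Lemma liftM : {morph lift : g h / g * h}.
Proof.
move=> g h; rewrite [LHS]lift_class /lift; elim: (fword g) => [|a s IHs] /=.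
  by rewrite mul1g.
by rewrite IHs mulgA.
Qed.

Lemma lift_gen x : lift (fgen x) = f x.
Proof. by rewrite lift_class /= mulg1. Qed.

Lemma liftV : {morph lift : g / g^-1}.
Proof. by move=> g; apply: (mulgI (lift g)); rewrite -liftM !mulgV. Qed.

End Lift.

(** * Derived subgroup and abelianisation *)

Section Subgroups.
Variable G : groupType.
Implicit Types (g h x y : G).

Lemma generated_subgroup (S : set G) : is_subgroup (generated S).
Proof.
split=> [H [[]] //|x y Sx Sy H HS|x Sx H HS]; have [[_ HM HV] _] := HS.
- by apply: HM; [apply: Sx | apply: Sy].
- by apply: HV; apply: Sx.
Qed.

Lemma derived_is_subgroup : is_subgroup (@derived_subgroup G).
Proof. exact: generated_subgroup. Qed.

Lemma derived_commutator g h : derived_subgroup (commutator g h).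
Proof. by apply: sub_gen_smallest; exists g => //; exists h. Qed.

Lemma derived_conj g h : derived_subgroup g -> derived_subgroup (h^-1 * g * h).
Proof.
have [_ dM _] := derived_is_subgroup.
move=> dg; have -> : h^-1 * g * h = g * commutator g^-1 h^-1.
  by rewrite /commutator !invgK !mulgA mulgV mul1g.
exact: dM dg (derived_commutator _ _).
Qed.

Lemma derived_sandwich g h k : derived_subgroup g -> derived_subgroup k ->
  derived_subgroup ((g * h * k)^-1 * h).
Proof.
have [_ dM dV] := derived_is_subgroup.
move=> dg dk; rewrite !invgM -mulgA; apply: dM; first exact: dV.
exact: derived_conj (dV _ dg).
Qed.

Lemma abel_classP g h : abel_class g = abel_class h <-> derived_subgroup (g^-1 * h).
Proof.
have [d1 dM dV] := derived_is_subgroup.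
split=> [E|d].
  have [d dd <-] : abel_class g h by rewrite E; exists 1; rewrite ?mulg1.
  by rewrite mulKg.
apply/seteqP; split=> _ [e de <-].
  by exists ((g^-1 * h)^-1 * e);
    [exact: dM (dV _ d) de | rewrite invgM invgK !mulgA mulgV mul1g].
by exists (g^-1 * h * e); [exact: dM | rewrite !mulgA mulgV mul1g].
Qed.

End Subgroups.

Arguments derived_is_subgroup : clear implicits.

(** * The integral Heisenberg group *)

Section Heisenberg.
Import GRing.Theory.
Local Open Scope ring_scope.

(* The triple (a, b, c) stands for the unitriangular matrix
   [[1, a, c], [0, 1, b], [0, 0, 1]]. *)
Definition heis : Type := (int * int * int)%type.

HB.instance Definition _ := Choice.on heis.

Definition heis_one : heis := (0, 0, 0).
Definition heis_mul (p q : heis) : heis :=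
  (p.1.1 + q.1.1, p.1.2 + q.1.2, p.2 + q.2 + p.1.1 * q.1.2).
Definition heis_inv (p : heis) : heis :=
  (- p.1.1, - p.1.2, p.1.1 * p.1.2 - p.2).

Lemma heis_mulA : associative heis_mul.
Proof. by move=> p q r; congr (_, _, _) => /=; ring. Qed.

Lemma heis_mul1 : left_id heis_one heis_mul.
Proof. by case=> [[a b] c]; congr (_, _, _) => /=; ring. Qed.

Lemma heis_mulr1 : right_id heis_one heis_mul.
Proof. by case=> [[a b] c]; congr (_, _, _) => /=; ring. Qed.

Lemma heis_mulV : left_inverse heis_one heis_inv heis_mul.
Proof. by move=> p; congr (_, _, _) => /=; ring. Qed.

Lemma heis_mulrV : right_inverse heis_one heis_inv heis_mul.
Proof. by move=> p; congr (_, _, _) => /=; ring. Qed.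

HB.instance Definition _ :=
  isGroup.Build heis heis_mulA heis_mul1 heis_mulr1 heis_mulV heis_mulrV.

(** The antiautomorphism fixing [(1, 0, 0)] and [(0, 1, 0)]; it changes the sign of [c - ab/2]. *)
Definition heis_rev (p : heis) : heis := (p.1.1, p.1.2, p.1.1 * p.1.2 - p.2).

Lemma heis_revM (p q : heis) : heis_rev (p * q)%g = (heis_rev q * heis_rev p)%g.
Proof. by congr (_, _, _) => /=; ring. Qed.

Lemma heis_revV (p : heis) : heis_rev p^-1%g = (heis_rev p)^-1%g.
Proof. by congr (_, _, _) => /=; ring. Qed.

Lemma heis_commutator (p q : heis) :
  commutator p q = (0, 0, p.1.1 * q.1.2 - q.1.1 * p.1.2).
Proof. by congr (_, _, _) => /=; ring. Qed.

Variables (X : choiceType) (x y : X).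

Definition heis_gen (z : X) : heis := ((z == x)%:Z, (z == y)%:Z, 0).

Definition heis_rep : free_group X -> heis := lift heis_gen.

(** The kernel of reduction modulo 2, hence a normal subgroup. *)
Definition even_heis : set heis :=
  [set p | [/\ (2 %| p.1.1)%Z, (2 %| p.1.2)%Z & (2 %| p.2)%Z]].

Lemma even_heis_mul p q : even_heis p -> even_heis q -> even_heis (p * q)%g.
Proof.
move=> [pa pb pc] [qa qb qc]; split=> /=; rewrite ?rpredD //.
exact: dvdz_mulr.
Qed.

Lemma even_heis_inv p : even_heis p -> even_heis p^-1%g.
Proof.
by move=> [pa pb pc]; split=> /=; rewrite ?rpredB ?rpredN // dvdz_mulr.
Qed.

Lemma even_heis_conj p q : even_heis p -> even_heis (q^-1 * p * q)%g.
Proof.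
move=> [pa pb pc]; split=> /=.
- by rewrite addrAC addNr add0r.
- by rewrite addrAC addNr add0r.
rewrite (_ : _ + _ = p.2 + p.1.1 * q.1.2 - q.1.1 * p.1.2); last by ring.
by apply: rpredB; [apply: rpredD => //; apply: dvdz_mulr | apply: dvdz_mull].
Qed.

End Heisenberg.

(** * Heisenberg representation of the free group *)

Section HeisenbergRepresentation.
Variables (X : choiceType) (x y : X) (nxy : x != y).
Implicit Types g h : free_group X.

Lemma heis_repM : {morph heis_rep x y : g h / g * h}. Proof. exact: liftM. Qed.
Lemma heis_repV : {morph heis_rep x y : g / g^-1}. Proof. exact: liftV. Qed.

Lemma heis_rep_frev g : heis_rep x y (frev g) = heis_rev (heis_rep x y g).
Proof.
(* As [x] and [y] differ, one of the first two coordinates is zero, so the product [ab] in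
   [heis_rev] vanishes. *)
have gen z : heis_rev (heis_gen x y z) = heis_gen x y z.
  congr (_, _, _) => /=; rewrite GRing.subr0.
  by case: (eqVneq z x) => [->|_]; rewrite ?(negPf nxy) ?GRing.mul0r.
elim/free_group_ind: g => [|z g IHg|z g IHg]; first by [].
  by rewrite frevM !heis_repM heis_revM IHg frev_gen /heis_rep lift_gen gen.
rewrite frevM frevV !heis_repM !heis_repV heis_revM heis_revV IHg frev_gen.
by rewrite /heis_rep lift_gen gen.
Qed.

Lemma parity_heis_rep g : parity x g = ~~ (2 %| (heis_rep x y g).1.1)%Z.
Proof.
elim/free_group_ind: g => [|z g IHg|z g IHg] //.
  rewrite heis_repM parityM parity_gen IHg /heis_rep lift_gen /=.
  by case: (z == x) => /=; lia.
rewrite heis_repM heis_repV parityM IHg.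
have -> : parity x (fgen z)^-1 = (z == x).
  have := parityM x (fgen z) (fgen z)^-1.
  by rewrite mulgV parity_gen; case: (parity x _^-1); case: (z == x).
rewrite /heis_rep lift_gen /=.
by case: (z == x) => /=; lia.
Qed.

Lemma heis_rep_derived g : derived_subgroup g ->
  exists c, heis_rep x y g = (0%R, 0%R, c).
Proof.
move: g; apply: smallest_sub => [|_ [h _ [k _ <-]]]; last first.
  by exists ((heis_rep x y h).1.1 * (heis_rep x y k).1.2 -
    (heis_rep x y k).1.1 * (heis_rep x y h).1.2)%R;
     rewrite -heis_commutator /commutator !(heis_repM, heis_repV).
split=> [|h k [c hc] [d kd]|h [c hc]].
- by exists 0%R.
- by exists (c + d)%R; rewrite heis_repM hc kd; congr (_, _, _) => /=; ring.
- by exists (- c)%R; rewrite heis_repV hc; congr (_, _, _) => /=; ring.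
Qed.

(* The fixed points [(a, b, c)] of [heis_rev] satisfy [2 c = a b], so a
   reversible element is determined by its image in the abelianisation. *)
Lemma heis_rep_symmetric_eq g h : frev g = g -> frev h = h ->
  derived_subgroup (g^-1 * h) -> heis_rep x y g = heis_rep x y h.
Proof.
move=> sg sh /heis_rep_derived[c E].
have {E} : heis_rep x y h = heis_rep x y g * (0%R, 0%R, c) :> heis.
  by rewrite -E -heis_repM mulgA mulgV mul1g.
have := heis_rep_frev g; have := heis_rep_frev h; rewrite sg sh.
case: (heis_rep x y g) => [[a b] k]; case: (heis_rep x y h) => [[a' b'] k'].
rewrite /heis_rev /= => -[e1] [e2] [ea eb e3]; move: e1.
rewrite ea eb !GRing.addr0 => e1.
by have -> : k = k' by lia.
Qed.

End HeisenbergRepresentation.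

(** * The subgroup with even conjugators *)

Section EvenConjugators.
Variables (X : choiceType) (x y : X).
Implicit Types (phi : aut (free_group X)) (u : free_group X).

(** The first two conditions make the third one multiplicative: the conjugator of [f * g] is
    [u * f v], and [f v] has the Heisenberg image of [v]. *)
Definition even_conjugator : set (aut (free_group X)) :=
  [set phi | [/\ forall g, heis_rep x y (phi g) = heis_rep x y g,
                 forall g, phi (frev g) = frev (phi g) &
                 exists2 u, phi (fgen x) = frev u * fgen x * u
                          & even_heis (heis_rep x y u)]].

Lemma even_conjugator_subgroup : is_subgroup even_conjugator.
Proof.
split=> [|f g [fr fC [u fu eu]] [gr gC [v gv ev]]|f [fr fC [u fu eu]]].
- by split=> //; exists 1; rewrite ?frev1 ?mul1g ?mulg1.
- split=> [k|k|] /=; first by rewrite fr gr.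
    by rewrite gC fC.
  exists (u * f v); last by rewrite heis_repM fr; apply: even_heis_mul.
  by rewrite gv !autM fC fu frevM !mulgA.
- have rI k : heis_rep x y (f^-1 k) = heis_rep x y k by rewrite -fr (aut_inv_funK f).
  have CI k : f^-1 (frev k) = frev (f^-1 k).
    by apply: (bij_inj (aut_bij f)); rewrite fC !(aut_inv_funK f).
  split=> //; exists (f^-1 u)^-1; last first.
    by rewrite heis_repV rI; apply: even_heis_inv.
  (* Apply [f^-1] to [f x = frev u * x * u] and solve for [f^-1 x]. *)
  have := aut_funK f (fgen x); rewrite -[aut_inv_fun f]/(aut_fun f^-1).
  rewrite fu !autM CI frevV => {2}<-.
  by rewrite !mulgA mulVg mul1g mulgK.
Qed.

End EvenConjugators.

(** * Palindromic automorphisms and doubled commutator transvections *)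

Section Torelli.
Variables (n : nat) (x y : 'I_n) (nxy : x != y).
Implicit Type phi : aut (free_group 'I_n).

(** A generator and its image are both reversal-invariant and agree in the abelianisation, so
    [heis_rep_symmetric_eq] applies. *)
Lemma torelli_heis_rep phi g : palindromic_torelli phi ->
  heis_rep x y (phi g) = heis_rep x y g.
Proof.
move=> [/palindromic_autP pC pT]; elim/free_group_ind: g => [|z g IHg|z g IHg].
- by rewrite aut1.
- rewrite autM !heis_repM IHg; congr (_ * _); apply: heis_rep_symmetric_eq => //.
  + by rewrite -pC frev_gen.
  + exact/abel_classP/pT.
- rewrite autM autV !heis_repM !heis_repV IHg; congr (_^-1 * _).
  apply: heis_rep_symmetric_eq => //.
  + by rewrite -pC frev_gen.
  + exact/abel_classP/pT.
Qed.

(* Modulo 2, palindromic automorphisms permute the generators. *)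
Lemma palindromic_aut_gen phi z : palindromic_aut phi ->
  exists a t, phi (fgen z) = frev a * fgen t * a.
Proof.
move=> pp; have /palindromic_autP pC := pp.
have /palindromic_autP pCI : palindromic_aut phi^-1.
  by have [_ _] := palindromic_aut_subgroup n; apply.
have : frev (phi (fgen z)) = phi (fgen z) by rewrite -pC frev_gen.
move=> /frev_fixed_split[a [E|[t E]]]; last by exists a, t.
(* An even palindrome [frev a * a] is impossible: [phi^-1] would send it to another element of that
   form, with all parities zero, yet it is sent to [z]. *)
have : parity z (fgen z) by rewrite parity_gen.
rewrite -[fgen z](aut_funK phi) E -[aut_inv_fun phi]/(aut_fun phi^-1).
by rewrite autM pCI parityM parity_frev addbb.
Qed.

(** If [phi (fgen c)] is odd in [t], it is centred at [t], so [fgen c] and [phi^-1 (fgen t)] have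
    equal parities; thus [t] determines [c]. *)
Lemma palindromic_aut_parity phi a b t : palindromic_aut phi ->
  parity t (phi (fgen a)) -> parity t (phi (fgen b)) -> a = b.
Proof.
move=> pp pa pb.
have /palindromic_autP pCI : palindromic_aut phi^-1.
  by have [_ _] := palindromic_aut_subgroup n; apply.
have gen c : parity t (phi (fgen c)) ->
    parity a (fgen c) = parity a (phi^-1 (fgen t)).
  have [u [s E]] := palindromic_aut_gen c pp.
  rewrite -{2}[fgen c](aut_funK phi) E -[aut_inv_fun phi]/(aut_fun phi^-1).
  rewrite parity_revconj parity_gen => /eqP ->.
  by rewrite !autM pCI parity_revconj.
by apply/esym/eqP; rewrite -parity_gen (gen b pb) -(gen a pa) parity_gen.
Qed.

(** The central coordinate of the commutator is a 2 by 2 determinant with one even column. *)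
Lemma even_heis_commutator g h : ~~ parity x g -> ~~ parity x h ->
  even_heis (heis_rep x y (commutator g h)).
Proof.
rewrite !(parity_heis_rep nxy) !negbK => eg eh.
rewrite /commutator !heis_repM !heis_repV -/(commutator _ _) heis_commutator.
by split=> //=; apply: GRing.rpredB; apply: dvdz_mulr.
Qed.

Lemma doubled_commutator_even_conjugator phi :
  doubled_commutator_transvection phi -> even_conjugator x y phi.
Proof.
move=> [Tphi [_ [[al pal ->] [y1 [y2 [y3 []]]]]]].
move=> [[i1 _ <-] [i2 _ <-] [i3 _ <-]] [n12 n13 n23] phi1 phi_fix {y1 y2 y3}.
have [/palindromic_autP pC _] := Tphi.
have rphi g := torelli_heis_rep g Tphi.
split=> //.
have pI : palindromic_aut al^-1.
  by have [_ _] := palindromic_aut_subgroup n; apply.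
have /palindromic_autP aC := pal.
(* Centre [x] at a member [al (fgen m)] of the pi-basis, where [phi] is known. *)
have [a [m E]] := palindromic_aut_gen x pI.
have {}E : fgen x = frev (al a) * al (fgen m) * al a.
  by rewrite -aC -!autM -E (aut_inv_funK al).
have [v [Ev ev]] : exists v,
    phi (al (fgen m)) = frev v * al (fgen m) * v /\ even_heis (heis_rep x y v).
  case: (eqVneq m i1) => [Em|nm]; last first.
    exists 1; rewrite frev1 mul1g mulg1; split=> //.
    apply: phi_fix; first by exists m.
    by move=> /(bij_inj (aut_bij al)) Em; move: (congr1 (parity m) Em);
      rewrite !parity_gen eqxx eq_sym (negPf nm).
  exists (commutator (al (fgen i2)) (al (fgen i3))); rewrite Em; split=> //.
  have pm : parity x (al (fgen i1)).
    by rewrite -Em -(parity_revconj x (al a)) -E parity_gen.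
  apply: even_heis_commutator; apply/negP => pk.
    by apply: n12; rewrite (palindromic_aut_parity pal pm pk).
  by apply: n13; rewrite (palindromic_aut_parity pal pm pk).
(* Found by substituting [al (fgen m) = (frev (al a))^-1 * x * (al a)^-1] in [phi x]. Since [phi]
   preserves [heis_rep], its image is a conjugate of that of [v]. *)
exists ((al a)^-1 * v * phi (al a)).
  rewrite {1}E !autM Ev pC E !frevM frevV !mulgA.
  by rewrite -!mulgA !(mulVKg, mulKg).
rewrite !heis_repM rphi heis_repV.
exact: even_heis_conj.
Qed.

End Torelli.

(** * The separating twist *)

Section SeparatingTwist.
Variables (X : choiceType) (x y z : X).
Hypotheses (nxy : x != y) (nxz : x != z) (nyz : y != z).
Implicit Types d g : free_group X.

(** With [e] inverting every generator, [e * (frev d * t * d)] is the conjugate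
    [d^-1 * (e * t) * d]. *)
Definition triple_conj_gen d (t : X) : free_group X :=
  if t \in [:: x; y; z] then frev d * fgen t * d else fgen t.

Definition triple_conj d : free_group X -> free_group X :=
  lift (triple_conj_gen d).

Lemma triple_conjM d : {morph triple_conj d : g h / g * h}.
Proof. exact: liftM. Qed.

Lemma triple_conjV d : {morph triple_conj d : g / g^-1}.
Proof. exact: liftV. Qed.

Lemma triple_conj_in d t :
  t \in [:: x; y; z] -> triple_conj d (fgen t) = frev d * fgen t * d.
Proof. by move=> tin; rewrite /triple_conj lift_gen /triple_conj_gen tin. Qed.

Lemma triple_conj_out d t :
  t \notin [:: x; y; z] -> triple_conj d (fgen t) = fgen t.
Proof.
by move=> /negPf tout; rewrite /triple_conj lift_gen /triple_conj_gen tout.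
Qed.

Lemma triple_conj_frev d g : triple_conj d (frev g) = frev (triple_conj d g).
Proof.
have gen t : frev (triple_conj d (fgen t)) = triple_conj d (fgen t).
  case: (boolP (t \in [:: x; y; z])) => [tin|tout].
    by rewrite triple_conj_in // !frevM frevK frev_gen mulgA.
  by rewrite triple_conj_out // frev_gen.
elim/free_group_ind: g => [|t g IHg|t g IHg].
- by rewrite frev1.
- by rewrite frevM !triple_conjM frevM IHg frev_gen gen.
- by rewrite frevM frevV !triple_conjM !triple_conjV frevM frevV IHg frev_gen gen.
Qed.

(* In [free_group X ><| <[e]>], with [e] inverting every generator, the elements
   [e * fgen t] are involutions and this word is the square of
   [(e * fgen x) * (e * fgen y) * (e * fgen z)]. *)
Definition sep_word : free_group X :=
  (fgen x)^-1 * fgen y * (fgen z)^-1 * fgen x * (fgen y)^-1 * fgen z.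

(** [sep_word] is a product of the involutions [e * x], [e * y], [e * z], all conjugated by the same
    [d]. In particular it is fixed when [d] is [sep_word]. *)
Lemma triple_conj_sep_word d : triple_conj d sep_word = d^-1 * sep_word * d.
Proof.
rewrite /sep_word !triple_conjM !triple_conjV.
rewrite !triple_conj_in ?inE ?eqxx ?orbT // !invgM.
by rewrite -!mulgA !(mulVKg, mulKg).
Qed.

Lemma triple_conjK d : triple_conj d^-1 d = d ->
  cancel (triple_conj d) (triple_conj d^-1).
Proof.
move=> fd; have gen t : triple_conj d^-1 (triple_conj d (fgen t)) = fgen t.
  case: (boolP (t \in [:: x; y; z])) => [tin|tout]; last by rewrite !triple_conj_out.
  rewrite (triple_conj_in d) // !triple_conjM triple_conj_frev fd triple_conj_in //.
  by rewrite frevV -!mulgA mulVg mulg1 mulVKg.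
elim/free_group_ind => [//|t g IHg|t g IHg].
- by rewrite (triple_conjM d) (triple_conjM d^-1) IHg gen.
- rewrite (triple_conjM d) (triple_conjV d) (triple_conjM d^-1).
  by rewrite (triple_conjV d^-1) IHg gen.
Qed.

Lemma triple_conj_bij : bijective (triple_conj sep_word).
Proof.
have fixV : triple_conj sep_word^-1 sep_word = sep_word.
  by rewrite triple_conj_sep_word invgK mulgK.
have fix1 : triple_conj sep_word sep_word^-1 = sep_word^-1.
  by rewrite triple_conjV triple_conj_sep_word mulVg mul1g.
exists (triple_conj sep_word^-1); first exact: triple_conjK.
by have := @triple_conjK sep_word^-1; rewrite invgK; apply.
Qed.

Definition sep_twist : aut (free_group X) :=
  Aut (@triple_conjM sep_word) triple_conj_bij.

Lemma sep_word_derived : derived_subgroup sep_word.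
Proof.
have [_ dM _] := derived_is_subgroup (free_group X).
have -> : sep_word = commutator (fgen x)^-1 (fgen y * (fgen z)^-1) *
    commutator (fgen y) (fgen z)^-1.
  by rewrite /sep_word /commutator !invgM !invgK -!mulgA !(mulVKg, mulKg).
by apply: dM; apply: derived_commutator.
Qed.

Lemma frev_sep_word_derived : derived_subgroup (frev sep_word).
Proof.
have [_ dM _] := derived_is_subgroup (free_group X).
have -> : frev sep_word = commutator (fgen z) (fgen y)^-1 *
    commutator ((fgen y)^-1 * fgen z) (fgen x).
  rewrite /sep_word !frevM !frevV !frev_gen /commutator !invgM !invgK.
  by rewrite -!mulgA !(mulVKg, mulKg).
by apply: dM; apply: derived_commutator.
Qed.

Lemma sep_twist_abel g : abel_class (sep_twist g) = abel_class g.
Proof.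
have [d1 dM dV] := derived_is_subgroup (free_group X).
have gen t : derived_subgroup ((sep_twist (fgen t))^-1 * fgen t).
  rewrite /=; case: (boolP (t \in [:: x; y; z])) => [tin|tout]; last first.
    by rewrite triple_conj_out // mulVg.
  rewrite triple_conj_in //.
  exact: derived_sandwich frev_sep_word_derived sep_word_derived.
apply/abel_classP; elim/free_group_ind: g => [|t g IHg|t g IHg].
- by rewrite aut1 invg1 mulg1.
- rewrite autM invgM (_ : _ * _ = (sep_twist g)^-1 * g * (g^-1 *
     ((sep_twist (fgen t))^-1 * fgen t) * g)); last first.
    by rewrite -!mulgA !(mulVKg, mulKg).
  by apply: dM => //; apply: derived_conj.
- rewrite autM autV invgM invgK (_ : _ * _ = (sep_twist g)^-1 * g * (g^-1 *
     ((fgen t)^-1^-1 * ((sep_twist (fgen t))^-1 * fgen t)^-1 * (fgen t)^-1)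
       * g)); last first.
    by rewrite !invgM !invgK -!mulgA !(mulVKg, mulKg).
  by apply: dM => //; do 2!apply: derived_conj; apply: dV (gen t).
Qed.

(** By uniqueness the conjugator is [sep_word]. Killing [z] leaves the commutator of [A^-1] and [B],
    with central coordinate -1. *)
Lemma sep_twist_not_even_conjugator : ~ even_conjugator x y sep_twist.
Proof.
move=> [_ _ [u]]; rewrite /= triple_conj_in ?inE ?eqxx // => /revconj_gen_inj <-.
case=> _ _; rewrite /sep_word !heis_repM !heis_repV /heis_rep !lift_gen /heis_gen /=.
by rewrite !eqxx (eq_sym y x) !(eq_sym z) (negPf nxy) (negPf nxz) (negPf nyz).
Qed.

End SeparatingTwist.

(** * Properness of the generated subgroup *)

Lemma sep_twist_torelli (n : nat) (x y z : 'I_n) :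
  palindromic_torelli (sep_twist x y z).
Proof.
split; last exact: sep_twist_abel.
by apply/palindromic_autP => g; apply: triple_conj_frev.
Qed.

Theorem proposition3p7 (n : nat) (hn : 3 <= n) :
  proper_subgroup (generated (@doubled_commutator_transvection n))
                  (@palindromic_torelli n).
Proof.
split; first exact: generated_subgroup.
pose x := Ordinal (ltn_trans (isT : 0 < 2) hn).
pose y := Ordinal (ltn_trans (isT : 1 < 2) hn).
pose z := Ordinal hn.
split=> [|sub].
  apply: smallest_sub; first exact: palindromic_torelli_subgroup.
  by move=> phi [].
apply: (@sep_twist_not_even_conjugator _ x y z) => //.
have : generated (@doubled_commutator_transvection n) (sep_twist x y z).
  exact: sub _ (sep_twist_torelli x y z).
apply: smallest_sub; first exact: even_conjugator_subgroup.
by move=> phi; apply: doubled_commutator_even_conjugator.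
Qed.
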